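(* Let all data below be as in the context: finite sets $\mathcal{N}$ (base stations) and $\mathcal{M}=\mathcal{M}_{\mathrm{no}}\sqcup\mathcal{M}_o$ (zones), association indicators $a_{m,n},b_{m,n},c_{m,n}$, vehicle densities $\rho_m$, zone length $L$, and service parameters $\lambda_u,\xi_u,\eta_u,R_n,F$. Let $S_{n,u},C_{n,u}$ ($n\in\mathcal{N}$) be any given positive integers (the resource allocation). Consider the problem $\mathbf{P}_{1,u}$ in the variable $\beta_u=(\beta_{m,u})_{m\in\mathcal{M}_o}\in\mathbb{R}^{|\mathcal{M}_o|}$: $$\min_{\beta_u}\ D_u(\beta_u)$$ subject to $$S_{n,u}-\frac{\xi_u}{R_n}\Big(\chi_{n,u}+\sum_{m\in\mathcal{M}_o}\psi_{m,n,u}\,\beta_{m,u}\Big)\ge 0\quad\forall n\in\mathcal{N},$$ $$C_{n,u}-\frac{\eta_u}{F}\Big(\chi_{n,u}+\sum_{m\in\mathcal{M}_o}\psi_{m,n,u}\,\beta_{m,u}\Big)\ge 0\quad\forall n\in\mathcal{N},$$ $$0\le \beta_{m,u}\le 1\quad\forall m\in\mathcal{M}_o,$$ where $D_u$ is the average service delay defined in the context. Then $\mathbf{P}_{1,u}$ is a convex optimization problem; that is, its constraints are affine in $\beta_u$ (so that its feasible set is convex), and its objective $D_u$ is a convex function of $\beta_u$ on the feasible set.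
   Context: Setting. $\mathcal{N}$ is a finite nonempty set of base stations (BSs), $N=|\mathcal{N}|$. $\mathcal{M}$ is a finite nonempty set of road zones, each of length $L>0$, and is the disjoint union of the set $\mathcal{M}_{\mathrm{no}}$ of non-overlapped zones (covered by a single BS) and the set $\mathcal{M}_o$ of overlapped zones. For $m\in\mathcal{M}_{\mathrm{no}}$, $c_{m,n}\in\{0,1\}$ equals $1$ exactly for the one BS $n$ with which zone $m$ is associated. Each $m\in\mathcal{M}_o$ is associated with two distinct BSs $n,n'$; $a_{m,\cdot}\in\{0,1\}$ equals $1$ exactly at $n$, and $b_{m,\cdot}\in\{0,1\}$ equals $1$ exactly at $n'$. The variable $\beta_{m,u}$ is the fraction of the workload of zone $m\in\mathcal{M}_o$ sent to BS $n$, the remaining fraction $1-\beta_{m,u}$ being sent to $n'$. Parameters. $\rho_m\ge 0$ is the vehicle density and $v_m>0$ the average velocity in zone $m$; $\lambda_u>0$ is the task arrival rate per vehicle, $\xi_u>0$ the task data size, $\eta_u>0$ the average task computation intensity; $R_n>0$ is the average transmission rate at BS $n$, $F>0$ the CPU frequency of one virtual machine instance, $D_H\ge 0$ the one-time handover delay. It is assumed that the total workload $\sum_{m\in\mathcal{M}}\lambda_u\rho_m L$ is positive. All these quantities are constants (not depending on $\beta_u$). Define, for $n\in\mathcal{N}$ and $m\in\mathcal{M}_o$, $$\chi_{n,u}=\sum_{m\in\mathcal{M}_{\mathrm{no}}}c_{m,n}\lambda_u\rho_mL+\sum_{m\in\mathcal{M}_o}b_{m,n}\lambda_u\rho_mL,\qquad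 \psi_{m,n,u}=(a_{m,n}-b_{m,n})\lambda_u\rho_mL,$$ $$x_n(\beta_u)=\chi_{n,u}+\sum_{m\in\mathcal{M}_o}\psi_{m,n,u}\beta_{m,u}\quad\text{(task arrival rate at BS } n).$$ The average offloading, processing and handover delays are $$D^o_{n,u}=\frac{1}{S_{n,u}R_n/\xi_u-x_n(\beta_u)},\qquad D^c_{n,u}=\frac{1}{C_{n,u}F/\eta_u-x_n(\beta_u)},\qquad D^h_u=\frac{D_HN}{\lambda_u\sum_{m\in\mathcal{M}}L/v_m},$$ and the average service delay is $$D_u(\beta_u)=D^h_u+\sum_{n\in\mathcal{N}}\frac{x_n(\beta_u)}{\sum_{m\in\mathcal{M}}\lambda_u\rho_mL}\big(D^o_{n,u}+D^c_{n,u}\big).$$ Convention: at feasible points where some denominator in $D^o_{n,u}$ or $D^c_{n,u}$ vanishes, the delay, and hence $D_u$, is taken to be $+\infty$; convexity is in the extended-real-valued sense. *)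

(* Defs.v *)
From HB Require Import structures.
From mathcomp Require Import all_boot all_order all_algebra.
From mathcomp Require Import boolp classical_sets reals constructive_ereal.
From mathcomp Require Import interval_inference convex.

Set Implicit Arguments.
Unset Strict Implicit.
Unset Printing Implicit Defensive.

Import Order.TTheory GRing.Theory Num.Theory.
Local Open Scope classical_set_scope.
Local Open Scope ring_scope.
Local Open Scope convex_scope.

Section OptimizationProblems.
Context {R : realType} {E : lmodType R}.

Definition affine_function (g : E -> R) : Prop :=
  exists (l : {scalar E}) (k : R), forall x, g x = l x + k.

(* The library's [convex_function] with values in [\bar R] instead of [R].
   In [\bar R], 0 * +oo = 0, so the cases t = 0 and t = 1 are harmless. *)
Definition ereal_convex_function (D : set (convex_lmodType E))
    (f : E -> \bar R) : Prop :=
  forall t : {i01 R}, {in D &, forall x y : convex_lmodType E,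
    (f (x <| t |> y) <= t%:num%:E * f x + (1 - t%:num)%:E * f y)%E}.

(* minimize [objective x] subject to [0 <= constraint i x] for all [i] *)
Record problem := Problem {
  constraint_index : Type;
  constraint : constraint_index -> E -> R;
  objective : E -> \bar R }.

Definition feasible (P : problem) : set (convex_lmodType E) :=
  [set x | forall i, 0 <= @constraint P i x].

Definition convex_problem (P : problem) : Prop :=
  [/\ forall i, affine_function (@constraint P i),
      convex_set (feasible P)
    & ereal_convex_function (feasible P) (@objective P)].

End OptimizationProblems.
Arguments problem {R} E.

(* The network and the parameters of one fixed service u. The zones are the
   elements of the disjoint union Mno + Mo of the non-overlapped and the
   overlapped ones. The boolean indicators assoc_a, assoc_b and assoc_c are
   a_{m,n}, b_{m,n} and c_{m,n}. *)
Record network (R : realType) (BS Mno Mo : finType) := Network {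
  assoc_a : Mo -> BS -> bool;
  assoc_b : Mo -> BS -> bool;
  assoc_c : Mno -> BS -> bool;
  rho : Mno + Mo -> R;     (* vehicle density *)
  vel : Mno + Mo -> R;     (* average velocity *)
  len : R;                 (* zone length L *)
  lambda : R;              (* task arrival rate per vehicle *)
  xi : R;                  (* task data size *)
  eta : R;                 (* task computation intensity *)
  rate : BS -> R;          (* average transmission rate R_n *)
  freq : R;                (* CPU frequency F of a virtual machine *)
  handover : R;            (* one-time handover delay D_H *)
  BS_nonempty : (0 < #|BS|)%N;
  zone_nonempty : (0 < #|{: Mno + Mo}|)%N;
  assoc_cP : forall m, exists n, forall k, assoc_c m k = (k == n);
  assoc_abP : forall m, exists n n', [/\ n != n',
    forall k, assoc_a m k = (k == n) & forall k, assoc_b m k = (k == n')];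
  rho_ge0 : forall m, 0 <= rho m;
  vel_gt0 : forall m, 0 < vel m;
  len_gt0 : 0 < len;
  lambda_gt0 : 0 < lambda;
  xi_gt0 : 0 < xi;
  eta_gt0 : 0 < eta;
  rate_gt0 : forall n, 0 < rate n;
  freq_gt0 : 0 < freq;
  handover_ge0 : 0 <= handover;
  workload_gt0 : 0 < \sum_(m : Mno + Mo) lambda * rho m * len }.

Section ServiceDelay.
Context {R : realType} {BS Mno Mo : finType} (w : network R BS Mno Mo).
Variables S C : BS -> nat.
Implicit Types (n : BS) (m : Mo) (beta : {ffun Mo -> R^o}).

Definition workload : R := \sum_(m : Mno + Mo) lambda w * rho w m * len w.

Definition chi n : R :=
  \sum_(m : Mno) (assoc_c w m n)%:R * lambda w * rho w (inl m) * len w +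
  \sum_(m : Mo) (assoc_b w m n)%:R * lambda w * rho w (inr m) * len w.

Definition psi m n : R :=
  ((assoc_a w m n)%:R - (assoc_b w m n)%:R) * lambda w * rho w (inr m) * len w.

Definition arrival n beta : R := chi n + \sum_(m : Mo) psi m n * beta m.

(* The outer inverse is that of [\bar R], for which 0^-1 = +oo: the delays are
   infinite exactly where their denominators vanish. *)
Definition offloading_delay n beta : \bar R :=
  (((S n)%:R * rate w n / xi w - arrival n beta)%:E^-1)%E.

Definition processing_delay n beta : \bar R :=
  (((C n)%:R * freq w / eta w - arrival n beta)%:E^-1)%E.

Definition handover_delay : R :=
  handover w * #|BS|%:R / (lambda w * \sum_(m : Mno + Mo) len w / vel w m).

(* A feasible point with an infinite delay at n has a positive arrival rate at
   n, so no product 0 * +oo occurs on the feasible set. *)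
Definition service_delay beta : \bar R :=
  (handover_delay%:E + \sum_(n : BS) (arrival n beta / workload)%:E *
     (offloading_delay n beta + processing_delay n beta))%E.

Inductive P1_index :=
  Offloading of BS | Processing of BS | Lower of Mo | Upper of Mo.

Definition P1_constraint (i : P1_index) beta : R :=
  match i with
  | Offloading n => (S n)%:R - xi w / rate w n *
      (chi n + \sum_(m : Mo) psi m n * beta m)
  | Processing n => (C n)%:R - eta w / freq w *
      (chi n + \sum_(m : Mo) psi m n * beta m)
  | Lower m => beta m
  | Upper m => 1 - beta m
  end.

Definition P1 : problem {ffun Mo -> R^o} := Problem P1_constraint service_delay.

End ServiceDelay.

(* Main.v *)
(* At a feasible point the arrival rate x_n at each BS satisfies
   0 <= x_n <= K, where K is the service capacity S_n R_n / xi or C_n F / eta,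
   and x_n is an affine function of beta. So D_u is, up to a constant, a sum of
   compositions of affine maps with x |-> (x / W) (K - x)^-1, and this function
   is convex on [0, K], with value +oo at K, because K > 0. *)
Require Import Defs.
From HB Require Import structures.
From mathcomp Require Import all_boot all_order all_algebra.
From mathcomp Require Import ring.
From mathcomp Require Import classical_sets reals constructive_ereal.
From mathcomp Require Import interval_inference convex.

Set Implicit Arguments.
Unset Strict Implicit.
Unset Printing Implicit Defensive.

Import Order.TTheory GRing.Theory Num.Theory.
Local Open Scope classical_set_scope.
Local Open Scope ring_scope.
Local Open Scope convex_scope.

Section Affine.
Context {R : realType}.

Lemma affine_function_conv (E : lmodType R) (g : E -> R) :
  affine_function g -> forall (t : {i01 R}) (x y : convex_lmodType E),
  g (x <| t |> y) = t%:num * g x + (1 - t%:num) * g y.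
Proof.
move=> [l [k gE]] t x y; rewrite !gE.
have -> : l (x <| t |> y) = t%:num * l x + (1 - t%:num) * l y.
  (* In [convex_lmodType E] the point [x <| t |> y] unfolds to [t *: x + (1 - t) *: y]. *)
  exact: etrans (linearD _ _ _) (congr2 _ (linearZ_LR _ _ _) (linearZ_LR _ _ _)).
ring.
Qed.

Lemma affine_function_lincomb (I : finType) (d : I -> R) (k : R) :
  affine_function (fun x : {ffun I -> R^o} => \sum_i d i * x i + k).
Proof.
pose f (x : {ffun I -> R^o}) : R := \sum_i d i * x i.
have flin : scalar f.
  move=> a x y; rewrite /f mulr_sumr -big_split /=.
  by apply: eq_bigr => i _; rewrite !ffunE mulrDr mulrCA.
pose l : {scalar {ffun I -> R^o}} :=
  HB.pack f (GRing.isLinear.Build _ _ _ _ f flin).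
by exists l, k.
Qed.

Lemma convex_set_affine_ge0 (E : lmodType R) (J : Type) (g : J -> E -> R) :
  (forall i, affine_function (g i)) ->
  convex_set ([set x | forall i, 0 <= g i x] : set (convex_lmodType E)).
Proof.
move=> gaff x y t; rewrite !inE /= => gx gy i.
rewrite (affine_function_conv (gaff i)).
by rewrite addr_ge0 // mulr_ge0 // ?subr_ge0.
Qed.

End Affine.

Section ErealConvex.
Context {R : realType} {E : lmodType R}.
Implicit Types (D : set (convex_lmodType E)) (f g : E -> \bar R).

Lemma ereal_convex_function_cst D (c : R) :
  ereal_convex_function D (fun=> c%:E).
Proof. by move=> t x y _ _; rewrite -!EFinM -EFinD -mulrDl subrKC mul1r. Qed.

(** Nonnegativity excludes sums of opposite infinities, so multiplication by [t] and [1 - t]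
    distributes over [f + g] in [\bar R]. *)
Lemma ereal_convex_functionD D f g :
  {in D, forall x : convex_lmodType E, (0 <= f x)%E} ->
  {in D, forall x : convex_lmodType E, (0 <= g x)%E} ->
  ereal_convex_function D f -> ereal_convex_function D g ->
  ereal_convex_function D (fun x => (f x + g x)%E).
Proof.
move=> f0 g0 fc gc t x y xD yD.
rewrite !ge0_muleDr ?f0 ?g0 // addeACA.
by apply: leeD; [exact: fc | exact: gc].
Qed.

Lemma ereal_convex_function_sum D (I : finType) (F : I -> E -> \bar R) :
  (forall i, {in D, forall x : convex_lmodType E, (0 <= F i x)%E}) ->
  (forall i, ereal_convex_function D (F i)) ->
  ereal_convex_function D (fun x => (\sum_i F i x)%E).
Proof.
move=> F0 Fc t x y xD yD.
rewrite !ge0_sume_distrr => [|i _|i _]; try exact: F0.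
by rewrite -big_split /=; apply: lee_sum => i _; exact: Fc.
Qed.

End ErealConvex.

Section Delay.
Context {R : realType}.

(** The mean sojourn time [1 / (K - x)] of an M/M/1 queue with service rate [K] and arrival rate
    [x], weighted by the share [x / W] of the total workload. *)
Definition weighted_delay (W K x : R) : \bar R := ((x / W)%:E * ((K - x)%:E^-1))%E.

Lemma weighted_delay_ge0 (W K x : R) :
  0 < W -> 0 <= x -> x <= K -> (0 <= weighted_delay W K x)%E.
Proof.
move=> W0 x0 xK; rewrite mule_ge0 ?inve_ge0 ?lee_fin ?subr_ge0 //.
by rewrite divr_ge0 // ltW.
Qed.

Lemma weighted_delay_fin (W K x : R) : x < K ->
  weighted_delay W K x = ((x / W) / (K - x))%:E.
Proof. by move=> xK; rewrite /weighted_delay inver subr_eq0 gt_eqF. Qed.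

Lemma weighted_delay_pinfty (W K : R) : 0 < W -> 0 < K ->
  weighted_delay W K K = +oo%E.
Proof.
by move=> W0 K0; rewrite /weighted_delay subrr inve0 gt0_muley // lte_fin divr_gt0.
Qed.

Lemma weighted_delay_convex (W K x y t : R) : 0 < W -> 0 < K ->
  0 <= x -> x <= K -> 0 <= y -> y <= K -> 0 <= t -> t <= 1 ->
  (weighted_delay W K (t * x + (1 - t) * y) <=
   t%:E * weighted_delay W K x + (1 - t)%:E * weighted_delay W K y)%E.
Proof.
move=> W0 K0 x0 xK y0 yK t0 t1.
(* For [t = 0] or [t = 1] a factor [0] may meet [+oo], and the product is [0]. Once these cases are
   gone, both weights are positive and preserve [+oo]. *)
have [->|tN0] := eqVneq t 0.
  by rewrite mul0r subr0 mul1r add0r mul0e mul1e add0e.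
have [->|tN1] := eqVneq t 1.
  by rewrite mul1r subrr mul0r addr0 mul1e mul0e adde0.
have {tN0}t_gt0 : 0 < t by rewrite lt_neqAle eq_sym tN0.
have {tN1}t_lt1 : 0 < 1 - t by rewrite subr_gt0 lt_neqAle tN1.
(* If [x = K] or [y = K], one term on the right is [+oo]; the other is not [-oo], so the sum is
   [+oo] and the inequality is trivial. *)
have term_neqNy (s z : R) : 0 <= s -> 0 <= z -> z <= K ->
    (s%:E * weighted_delay W K z != -oo)%E.
  move=> s0 z0 zK; rewrite -ltNye; apply: lt_le_trans (ltNyr 0) _.
  by rewrite mule_ge0 ?weighted_delay_ge0 ?lee_fin.
have [->|xNK] := eqVneq x K.
  rewrite [weighted_delay W K K]weighted_delay_pinfty // gt0_muley ?lte_fin //.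
  by rewrite addye ?leey // term_neqNy // ltW.
have [->|yNK] := eqVneq y K.
  rewrite [weighted_delay W K K]weighted_delay_pinfty // gt0_muley ?lte_fin //.
  by rewrite addey ?leey // term_neqNy.
have {}xK : x < K by rewrite lt_neqAle xNK.
have {}yK : y < K by rewrite lt_neqAle yNK.
have p0 : 0 < K - x by rewrite subr_gt0.
have q0 : 0 < K - y by rewrite subr_gt0.
have r0 : 0 < t * (K - x) + (1 - t) * (K - y).
  by rewrite addr_gt0 // mulr_gt0.
have rE : K - (t * x + (1 - t) * y) = t * (K - x) + (1 - t) * (K - y) by ring.
rewrite !weighted_delay_fin // ?rE; last by rewrite -subr_gt0 rE.
rewrite -!EFinM -EFinD lee_fin.
rewrite -subr_ge0.
(* With p = K - x, q = K - y and r = t p + (1 - t) q, the convexity gap of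
   x / (K - x) = K / p - 1 is K t (1 - t) (p - q)^2 / (p q r). *)
have -> : t * (x / W / (K - x)) + (1 - t) * (y / W / (K - y)) -
    (t * x + (1 - t) * y) / W / (t * (K - x) + (1 - t) * (K - y)) =
    K * t * (1 - t) * (x - y) ^+ 2 /
    (W * (K - x) * (K - y) * (t * (K - x) + (1 - t) * (K - y))).
  by field; rewrite !gt_eqF.
have gap_ge0 : 0 <= (x - y) ^+ 2 := sqr_ge0 _.
by rewrite divr_ge0 ?(mulr_ge0 _ gap_ge0) ?mulr_ge0 //; exact: ltW.
Qed.

Lemma weighted_delay_affine_convex (E : lmodType R)
    (D : set (convex_lmodType E)) (W K : R) (g : E -> R) : 0 < W -> 0 < K ->
  affine_function g -> {in D, forall x : convex_lmodType E, 0 <= g x <= K} ->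
  ereal_convex_function D (fun x => weighted_delay W K (g x)).
Proof.
move=> W0 K0 gaff gD t x y /gD /andP[gx0 gxK] /gD /andP[gy0 gyK].
by rewrite (affine_function_conv gaff) weighted_delay_convex.
Qed.

End Delay.

(** Solving a resource constraint for the arrival rate turns it into the nonnegativity of a delay
    denominator. *)
Lemma le_capacity (R : realType) (s p r x : R) :
  0 < p -> 0 < r -> 0 <= s - p / r * x -> x <= s * r / p.
Proof.
move=> p0 r0; rewrite subr_ge0 ler_pdivlMr // => le_s.
by rewrite mulrC -ler_pdivrMr // mulrAC.
Qed.

Section Network.
Context {R : realType} {BS Mno Mo : finType} (w : network R BS Mno Mo).
Variables S C : BS -> nat.

Lemma arrival_affine n : affine_function (arrival w n).
Proof.
have [l [k lE]] := affine_function_lincomb (psi w ^~ n) (chi w n).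
by exists l, k => x; rewrite -lE /arrival addrC.
Qed.

Lemma P1_constraint_affine i : affine_function (P1_constraint w S C i).
Proof.
(* Covers both resource constraints, with [k] equal to [xi / rate] or [eta / freq]. *)
have resource (s k : R) n :
    affine_function (fun beta => s - k * arrival w n beta).
  have [l [h lE]] := affine_function_lincomb (fun m => - k * psi w m n)
    (s - k * chi w n).
  exists l, h => x; rewrite -lE /arrival mulrDr opprD addrA addrC.
  congr (_ + _); rewrite mulr_sumr -sumrN.
  by apply: eq_bigr => m _; rewrite mulrA !mulNr.
(* Kronecker deltas as coefficients bring the box constraints under [affine_function_lincomb]. *)
have coord (m : Mo) (beta : {ffun Mo -> R^o}) :
    \sum_j (j == m)%:R * beta j = beta m :> R.
  rewrite (bigD1 m) //= eqxx mul1r big1 ?addr0 // => j /negPf ->.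
  by rewrite mul0r.
case: i => [n|n|m|m] /=; [exact: resource..| |].
  have [l [h lE]] := affine_function_lincomb (fun j => (j == m)%:R : R) 0.
  by exists l, h => x; rewrite -lE coord addr0.
have [l [h lE]] := affine_function_lincomb (fun j => - (j == m)%:R : R) 1.
exists l, h => x; rewrite -lE addrC /= -(coord m x) -sumrN.
by congr (_ + _); apply: eq_bigr => j _; rewrite mulNr.
Qed.

(** Since [psi] may be negative, its sum is first merged with the overlapped part of [chi]. Each
    zone then contributes its workload times [a * beta m + b * (1 - beta m)], which is nonnegative
    for [beta m] in [[0, 1]]. *)
Lemma arrival_ge0 n (beta : {ffun Mo -> R^o}) :
  (forall m, 0 <= (beta m : R) <= 1) -> 0 <= arrival w n beta.
Proof.
move=> beta01; have l0 := ltW (lambda_gt0 w); have L0 := ltW (len_gt0 w).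
rewrite /arrival /chi /psi -addrA -big_split addr_ge0 ?sumr_ge0 //= => m _.
  by rewrite !mulr_ge0 // rho_ge0.
have /andP[b0 b1] := beta01 m.
set b : R := (assoc_b w m n)%:R; set a : R := (assoc_a w m n)%:R.
have -> : b * lambda w * rho w (inr m) * len w +
    (a - b) * lambda w * rho w (inr m) * len w * beta m =
    (a * beta m + b * (1 - beta m)) * (lambda w * rho w (inr m) * len w).
  by ring.
by rewrite mulr_ge0 ?addr_ge0 ?mulr_ge0 ?subr_ge0 // rho_ge0.
Qed.

Lemma handover_delay_ge0 : 0 <= handover_delay w.
Proof.
rewrite divr_ge0 ?mulr_ge0 ?handover_ge0 ?(ltW (lambda_gt0 w)) //.
by rewrite sumr_ge0 // => m _; rewrite divr_ge0 ?ltW ?len_gt0 ?vel_gt0.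
Qed.

Lemma feasible_arrival n : {in feasible (P1 w S C),
  forall beta : convex_lmodType {ffun Mo -> R^o},
  [/\ 0 <= arrival w n beta, arrival w n beta <= (S n)%:R * rate w n / xi w
    & arrival w n beta <= (C n)%:R * freq w / Defs.eta w]}.
Proof.
move=> beta; rewrite inE => feas; split.
- apply: arrival_ge0 => m; apply/andP; split; first exact: (feas (Lower m)).
  by have := feas (Upper m); rewrite subr_ge0.
- apply: le_capacity (xi_gt0 w) (rate_gt0 w n) _.
  exact: (feas (Offloading n)).
- apply: le_capacity (eta_gt0 w) (freq_gt0 w) _.
  exact: (feas (Processing n)).
Qed.

End Network.

Theorem theorem1 (R : realType) (BS Mno Mo : finType)
    (w : network R BS Mno Mo) (S C : BS -> nat)
    (S_gt0 : forall n : BS, (0 < S n)%N) (C_gt0 : forall n : BS, (0 < C n)%N) :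
  convex_problem (P1 w S C).
Proof.
have W0 : 0 < workload w := workload_gt0 w.
split; first exact: P1_constraint_affine.
  exact: convex_set_affine_ge0 (P1_constraint_affine w S C).
set D := feasible _.
pose offl n beta :=
  weighted_delay (workload w) ((S n)%:R * rate w n / xi w) (arrival w n beta).
pose proc n beta :=
  weighted_delay (workload w) ((C n)%:R * freq w / Defs.eta w)
    (arrival w n beta).
have offl_ge0 n :
    {in D, forall x : convex_lmodType {ffun Mo -> R^o}, (0 <= offl n x)%E}.
  by move=> x /(feasible_arrival n)[? ? ?]; exact: weighted_delay_ge0.
have proc_ge0 n :
    {in D, forall x : convex_lmodType {ffun Mo -> R^o}, (0 <= proc n x)%E}.
  by move=> x /(feasible_arrival n)[? ? ?]; exact: weighted_delay_ge0.
(* Feasibility makes both inverses nonnegative, so the weight of BS [n] distributes over its two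
   delays. *)
have delayE : {in D, forall x : convex_lmodType {ffun Mo -> R^o},
    service_delay w S C x =
    ((handover_delay w)%:E + \sum_n (offl n x + proc n x))%E}.
  move=> x xD; congr (_ + _)%E; apply: eq_bigr => n _.
  have [_ leS leC] := feasible_arrival n xD.
  by rewrite ge0_muleDr // inve_ge0 lee_fin subr_ge0.
have term_ge0 n : {in D, forall x : convex_lmodType {ffun Mo -> R^o},
    (0 <= offl n x + proc n x)%E}.
  by move=> x xD; rewrite adde_ge0 ?offl_ge0 ?proc_ge0.
suff conv_delay : ereal_convex_function D (fun x : {ffun Mo -> R^o} =>
    ((handover_delay w)%:E + \sum_n (offl n x + proc n x))%E).
  (* [delayE] holds on [D] only, so rewriting at the convex combination uses the convexity of the
     feasible set. *)
  move=> t x y xD yD /=; rewrite !delayE //; first exact: conv_delay.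
  exact: (convex_set_affine_ge0 (P1_constraint_affine w S C)).
apply: ereal_convex_functionD => [x _|x xD||].
- by rewrite lee_fin handover_delay_ge0.
- by rewrite sume_ge0 // => n _; exact: term_ge0.
- exact: ereal_convex_function_cst.
apply: ereal_convex_function_sum => // n.
apply: ereal_convex_functionD; [exact: offl_ge0|exact: proc_ge0| |].
- apply: weighted_delay_affine_convex => //; last 2 first.
  + exact: arrival_affine.
  + by move=> x /(feasible_arrival n)[-> ->].
  (* The capacity is positive because [S n] is a positive integer. *)
  by rewrite divr_gt0 ?mulr_gt0 ?xi_gt0 ?rate_gt0 // ltr0n.
- apply: weighted_delay_affine_convex => //; last 2 first.
  + exact: arrival_affine.
  + by move=> x /(feasible_arrival n)[-> _ ->].
  by rewrite divr_gt0 ?mulr_gt0 ?eta_gt0 ?freq_gt0 // ltr0n.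
Qed.
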